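(* Let $\mathbf{G}\in\mathbb{F}_q^{n\times k}$ be the generator matrix of a balanced Reed–Solomon MDS code $\mathsf{BRS}_q[n,k]$ defined by the polynomials $$p_j(\mathsf{x})=\prod_{i:\mathbf{M}_{ij}=0}\left(\frac{\mathsf{x}-\beta_i}{\beta_j-\beta_i}\right)\in\mathbb{F}_q[\mathsf{x}],\qquad j=1,\dots,k,$$ through $\mathbf{G}_{ij}=p_j(\beta_i)$, with $\mathbf{M}$, $\beta_i$ and the parameters as in the context. Then $\mathbf{G}$ solves the optimization problem $$\begin{aligned}\arg\min_{\mathbf{G}\in\mathbb{F}_q^{n\times k}}\quad & \big\{\mathrm{nnzr}(\mathbf{G})\big\}\\ \text{s.t.}\quad & \|\mathbf{G}_{(i)}\|_0=w\quad\forall i\in\{1,\dots,n\},\\ & \|\mathbf{G}^{(j)}\|_0=d\quad\forall j\in\{1,\dots,k\},\\ & \mathrm{rank}(\mathbf{G}_{\mathcal{I}})=k\quad\forall\,\mathcal{I}\subseteq\{1,\dots,n\}\text{ with }|\mathcal{I}|=k.\end{aligned}$$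
   Context: Parameters: integers $q>n>k$ with $\mathbb{F}_q$ the finite field of $q$ elements; $d=n-k+1=\frac{nw}{k}$ is a positive integer (the distance of the code), so $w=\frac{kd}{n}$; and $d\geq n/2$. $\beta$ is a primitive root of $\mathbb{F}_q$ (a generator of $\mathbb{F}_q^\times$), and $\beta_i=\beta^i$ for $i=1,\dots,n$ are distinct points with $\{\beta_i\}_{i=1}^n\subsetneq\mathbb{F}_q^\times$. $\mathbf{M}\in\{0,1\}^{n\times k}$ is a sparsest and balanced mask matrix: every column has exactly $d$ ones and every row has exactly $w$ ones. The polynomials are intended to satisfy $p_j(\beta_i)=0$ if and only if $\mathbf{M}_{ij}=0$. A balanced Reed–Solomon code is a linear MDS code (distance $n-k+1$) with a generator matrix that is sparsest and balanced. Generator matrices are used in transposed form: $\mathbf{G}$ is $n\times k$ and its columns generate the code; each column has exactly $d$ nonzero entries and each row exactly $w$ nonzero entries. Notation: $\mathbf{G}_{(i)}$ and $\mathbf{G}^{(j)}$ are the $i$-th row and $j$-th column; $\|\cdot\|_0$ is the number of nonzero entries of a vector; $\mathrm{nnzr}(\mathbf{G})$ is the number of nonzero entries of $\mathbf{G}$; $\mathbf{G}_{\mathcal{I}}$ is the submatrix of rows indexed by $\mathcal{I}$. *)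

(* Defs.v *)
From mathcomp Require Import all_boot all_algebra all_fingroup all_solvable.

Set Implicit Arguments.
Unset Strict Implicit.
Unset Printing Implicit Defensive.

Import GRing.Theory.
Local Open Scope ring_scope.

(* On a row or a column this is the l_0 "norm", i.e. the Hamming weight. *)
Definition nnzr (F : nzRingType) (m n : nat) (A : 'M[F]_(m, n)) : nat :=
  #|[set ij : 'I_m * 'I_n | A ij.1 ij.2 != 0]|.

Definition row_submx (F : nzRingType) (n k : nat) (I : {set 'I_n})
    (A : 'M[F]_(n, k)) : 'M[F]_(#|I|, k) :=
  rowsub (fun t : 'I_#|I| => enum_val t) A.

(* Codewords are column vectors; the Hamming distance of u and v is
   nnzr (u - v). *)
Definition min_distance (F : fieldType) (n : nat)
    (C : {vspace 'cV[F]_n}) (d : nat) : Prop :=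
  (exists u v : 'cV[F]_n,
     [/\ u \in C, v \in C, u != v & nnzr (u - v) = d]) /\
  (forall u v : 'cV[F]_n,
     u \in C -> v \in C -> u != v -> (d <= nnzr (u - v))%N).

Definition MDS (F : fieldType) (n k : nat) (C : {vspace 'cV[F]_n}) : Prop :=
  \dim C = k /\ min_distance C (n - k + 1).

(* Transposed convention: the columns of G generate the code. *)
Definition generator_matrix (F : fieldType) (n k : nat)
    (C : {vspace 'cV[F]_n}) (G : 'M[F]_(n, k)) : Prop :=
  <<[seq col j G | j <- enum 'I_k]>>%VS = C.

Definition sparsest_balanced (F : fieldType) (n k d w : nat)
    (G : 'M[F]_(n, k)) : Prop :=
  (forall i : 'I_n, nnzr (row i G) = w) /\
  (forall j : 'I_k, nnzr (col j G) = d).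

Definition balanced_RS (F : fieldType) (n k d w : nat)
    (C : {vspace 'cV[F]_n}) : Prop :=
  MDS k C /\
  exists G : 'M[F]_(n, k), generator_matrix C G /\ sparsest_balanced d w G.

Definition sparsest_balanced_mask (n k d w : nat) (M : 'M[bool]_(n, k)) : Prop :=
  (forall j : 'I_k, #|[set i : 'I_n | M i j]| = d) /\
  (forall i : 'I_n, #|[set j : 'I_k | M i j]| = w).

(* Indices start at 0, so this is the (i+1)-st power of b; i is a mere nat so
   that both row indices ('I_n) and column indices ('I_k) can be used. *)
Definition eval_pt (F : finFieldType) (b : {unit F}) (i : nat) : F :=
  FinRing.uval b ^+ i.+1.

(* If M j j = false the defining formula divides by 0; with the convention
   0^-1 = 0 the polynomial is then 0, so the matrix of its values cannot have
   rank k and does not generate a k-dimensional code. *)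
Definition mask_poly (F : finFieldType) (n k : nat) (b : {unit F})
    (M : 'M[bool]_(n, k)) (j : 'I_k) : {poly F} :=
  \prod_(i < n | ~~ M i j)
     ((eval_pt b j - eval_pt b i)^-1 *: ('X - (eval_pt b i)%:P)).

Definition feasible (F : fieldType) (n k d w : nat) (G : 'M[F]_(n, k)) : Prop :=
  [/\ forall i : 'I_n, nnzr (row i G) = w,
      forall j : 'I_k, nnzr (col j G) = d
    & forall I : {set 'I_n}, #|I| = k -> \rank (row_submx I G) = k].

Definition is_argmin (T : Type) (P : T -> Prop) (f : T -> nat) (x : T) : Prop :=
  P x /\ forall y : T, P y -> (f x <= f y)%N.

(* Main.v *)
(* The problem is governed by its constraints: every feasible matrix has k
   columns of weight d, so all of them have the same number k * d of nonzero
   entries and only the feasibility of G is at stake. The columns of G are a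
   basis of C, so no p_j vanishes identically; hence p_j(beta_i) = 0 exactly
   when M_ij = 0, and the weights of G are those of the mask. The rank condition
   is the MDS property. *)
Require Import Defs.
From mathcomp Require Import all_boot all_algebra all_fingroup all_solvable.

Set Implicit Arguments.
Unset Strict Implicit.
Unset Printing Implicit Defensive.

Import GRing.Theory.
Local Open Scope ring_scope.

Lemma nnzr_col (F : nzRingType) (n k : nat) (A : 'M[F]_(n, k)) (j : 'I_k) :
  nnzr (col j A) = #|[set i | A i j != 0]|.
Proof.
rewrite /nnzr -(card_imset _ (f := fun i : 'I_n => (i, 0 : 'I_1))).
  apply: eq_card => -[i z]; rewrite !inE /= mxE ord1.
  by apply/idP/imsetP => [Ai | [i' + [->]]]; [exists i; rewrite ?inE | rewrite inE].
by move=> i i' [].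
Qed.

Lemma nnzr_row (F : nzRingType) (n k : nat) (A : 'M[F]_(n, k)) (i : 'I_n) :
  nnzr (row i A) = #|[set j | A i j != 0]|.
Proof.
rewrite /nnzr -(card_imset _ (f := fun j : 'I_k => (0 : 'I_1, j))).
  apply: eq_card => -[z j]; rewrite !inE /= mxE ord1.
  by apply/idP/imsetP => [Aj | [j' + [->]]]; [exists j; rewrite ?inE | rewrite inE].
by move=> j j' [].
Qed.

Lemma nnzr_sum_col (F : nzRingType) (n k : nat) (A : 'M[F]_(n, k)) :
  nnzr A = (\sum_j nnzr (col j A))%N.
Proof.
under eq_bigr do rewrite nnzr_col -sum1dep_card.
rewrite (exchange_big_dep xpredT) //= pair_big_dep /= /nnzr -sum1dep_card.
by apply: eq_bigl => ij; rewrite ?inE.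
Qed.

Section GeneratorMatrix.

Variables (F : fieldType) (n k : nat) (C : {vspace 'cV[F]_n}).
Variable G : 'M[F]_(n, k).
Hypothesis genG : generator_matrix C G.

Lemma mulmx_sum_col (v : 'cV[F]_k) : G *m v = \sum_j v j 0 *: col j G.
Proof.
apply/colP => i; rewrite mxE summxE; apply: eq_bigr => j _.
by rewrite !mxE mulrC.
Qed.

Lemma mulmx_generator_in (v : 'cV[F]_k) : G *m v \in C.
Proof.
rewrite mulmx_sum_col; apply: memv_suml => j _; apply: memvZ.
by rewrite -genG; apply/memv_span/map_f/mem_enum.
Qed.

Hypothesis dimC : \dim C = k.

(** The [k] columns of [G] span a space of dimension [k], so they are free, and [G *m v] is their
    combination with coefficients [v]. *)
Lemma generator_matrix_inj (v : 'cV[F]_k) : G *m v = 0 -> v = 0.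
Proof.
have /freeP freeG : free [tuple of [seq col j G | j <- ord_tuple k]].
  by rewrite /free genG dimC size_map size_enum_ord.
rewrite mulmx_sum_col => Gv0; apply/colP => j; rewrite mxE.
apply: (freeG (fun j => v j 0)); rewrite -[RHS]Gv0; apply: eq_bigr => i _.
by rewrite -tnth_nth tnth_map tnth_ord_tuple.
Qed.

Lemma generator_col_neq0 (j : 'I_k) : col j G != 0.
Proof.
apply/eqP; rewrite colE => /generator_matrix_inj/colP/(_ j)/eqP.
by rewrite !mxE !eqxx oner_eq0.
Qed.

End GeneratorMatrix.

(* A codeword vanishing on k positions has weight at most n - k, which is below
   the minimum distance. *)
Lemma MDS_rank_row_submx (F : fieldType) (n k : nat) (C : {vspace 'cV[F]_n})
    (G : 'M[F]_(n, k)) (I : {set 'I_n}) :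
  MDS k C -> generator_matrix C G -> #|I| = k -> \rank (row_submx I G) = k.
Proof.
move=> [dimC [_ distC]] genG cardI.
(* The transpose has [k] rows, so rank [k] means that no nonzero [v] kills it; such a [v] would give
   the nonzero codeword [G *m v^T], to be compared with the codeword 0. *)
rewrite -mxrank_tr; apply/eqP; apply: inj_row_free => v vG0.
suffices: v^T = 0 by move/(congr1 trmx); rewrite trmxK trmx0.
apply: (generator_matrix_inj genG dimC); apply/eqP/contraT => Gv_neq0.
have := distC _ 0 (mulmx_generator_in genG v^T) (mem0v _) Gv_neq0.
suffices: (nnzr (G *m v^T - 0) <= n - k)%N.
  by move=> le_nk; rewrite addn1 ltnNge le_nk.
rewrite subr0 nnzr_sum_col big_ord1 nnzr_col.
have ->: (n - k = #|~: I|)%N.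
  by rewrite -[n in LHS]card_ord -(cardsC I) cardI addKn.
apply/subset_leq_card/subsetP => i; rewrite !inE.
(* For [i] in [I], entry [i] of [G *m v^T] is an entry of the vanishing product [vG0]. *)
apply: contra_neqN => Ii; have /rowP/(_ (enum_rank_in Ii i)) := vG0.
rewrite !mxE => {2}<-; apply: eq_bigr => j _.
by rewrite !mxE enum_rankK_in // mulrC.
Qed.

(** A nonzero product has nonzero scalar factors, which excludes the degenerate inverses [0^-1 = 0];
    its roots are then exactly the points masked out in column [j], and distinct indices give
    distinct points. *)
Lemma horner_mask_poly_neq0 (F : finFieldType) (n k : nat) (b : {unit F})
    (M : 'M[bool]_(n, k)) (i : 'I_n) (j : 'I_k) :
  injective (fun i : 'I_n => eval_pt b i) -> mask_poly b M j != 0 ->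
  ((mask_poly b M j).[eval_pt b i] != 0) = M i j.
Proof.
move=> inj_b; rewrite /mask_poly prodf_seq_neq0 => /allP p_neq0.
rewrite horner_prod prodf_seq_neq0.
apply/allP/idP => [/(_ i (mem_index_enum _)) | Mij i' _].
  by apply: contraLR => /[dup] Mij -> /=; rewrite !hornerE subrr mulr0 eqxx.
apply/implyP => Mi'j.
have := p_neq0 i' (mem_index_enum _); rewrite Mi'j /= scaler_eq0 negb_or.
case/andP=> c_neq0 _; rewrite !hornerE mulf_neq0 // subr_eq0.
by apply: contraNneq Mi'j => /inj_b <-.
Qed.

Theorem lemma3 (F : finFieldType) (q n k d w : nat)
  (b : {unit F}) (M : 'M[bool]_(n, k))
  (C : {vspace 'cV[F]_n}) (G : 'M[F]_(n, k))
  (hq : #|F| = q) (hnq : (n < q)%N) (hkn : (k < n)%N) (hk : (0 < k)%N)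
  (hd : d = (n - k + 1)%N) (hw : (n * w = k * d)%N) (hdn : (n <= 2 * d)%N)
  (hb : generator [set: {unit F}] b)
  (hinj : injective (fun i : 'I_n => eval_pt b i))
  (hproper : [set eval_pt b i | i : 'I_n] \proper [set x : F | x != 0])
  (hM : sparsest_balanced_mask d w M)
  (hC : balanced_RS k d w C)
  (hGC : generator_matrix C G)
  (hG : forall (i : 'I_n) (j : 'I_k), G i j = (mask_poly b M j).[eval_pt b i]) :
  is_argmin (@feasible F n k d w) (@nnzr F n k) G.
Proof.
have [mdsC _] := hC; have [dimC _] := mdsC.
have nzG i j : (G i j != 0) = M i j.
  rewrite hG; apply: horner_mask_poly_neq0 => //.
  (* If the polynomial were zero, column [j] of [G] would vanish. *)
  apply: contra_neq (generator_col_neq0 hGC dimC j) => p0.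
  by apply/colP => i'; rewrite !mxE hG p0 horner0.
have [colM rowM] := hM.
have feasG : feasible d w G.
  split=> [i | j | I cardI].
  - by rewrite nnzr_row -(rowM i); apply: eq_card => j; rewrite !inE nzG.
  - by rewrite nnzr_col -(colM j); apply: eq_card => i; rewrite !inE nzG.
  - exact: MDS_rank_row_submx mdsC hGC cardI.
split=> // A [_ colA _]; have [_ colG _] := feasG.
(* Column by column, both matrices have weight [d], so the two totals agree. *)
by rewrite !nnzr_sum_col; apply: leq_sum => j _; rewrite colA colG.
Qed.
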